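(* For every $0<\alpha<0.5$ and all sufficiently large $n$, there exists a binary $k$-batch code $[N,n,k]^B$ with redundancy $r=N-n$ such that $$k=\Theta\big((n/\log n)^{0.5-\alpha}\big),\qquad r=\mathcal{O}\big(n^{1-\frac{\alpha}{3}}(\log n)^{\frac{\alpha}{3}}\big).$$ In particular, for $0<\epsilon<0.5$: $r_B\big(n,k=\Omega(n^{\epsilon^-})\big)=\mathcal{O}\big(n^{\delta(\epsilon)^+}\big)$ where $\delta(\epsilon)=\frac56+\frac{\epsilon}{3}$, and $r_B\big(n,k=\Theta(n^\epsilon)\big)=o(n)$. For $\epsilon\ge0.5$, there exists a binary $k$-batch code $[N,n,k]^B$ of dimension $n$ with $k=\Theta(n^\epsilon)$ and $N=\mathcal{O}(n^{0.5+\epsilon^+})$.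
   Context: A binary $[N,n,k]^B$ code ($k$-batch code) is a binary linear code of length $N$ encoding $n$ information bits $x_1,\dots,x_n$ such that for every multiset $\{i_1,\dots,i_k\}$ of indices there exist $k$ mutually disjoint sets $R_1,\dots,R_k\subseteq\{1,\dots,N\}$ such that, for each $j$, $x_{i_j}$ is a function of the codeword bits indexed by $R_j$. Its redundancy is $N-n$; $r_B(n,k)$ is the minimum redundancy of a binary $[N,n,k]^B$ code. Notation: $f(n)=\Omega(n^{a^-})$ means $f(n)=\Omega(n^{a-\tau})$ for all $\tau>0$; $f(n)=\mathcal{O}(n^{a^+})$ means $f(n)=\mathcal{O}(n^{a+\tau})$ for all $\tau>0$; $r_B(n,k=\Omega(n^{\epsilon^-}))=\mathcal{O}(n^{\delta^+})$ means there exist binary $k$-batch codes of dimension $n$ with $k=\Omega(n^{\epsilon^-})$ and redundancy $\mathcal{O}(n^{\delta^+})$. Logarithms are to base 2. *)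

(* Defs.v *)
From Stdlib Require Import Reals.
From mathcomp Require Import all_boot all_algebra.

Set Implicit Arguments. Unset Strict Implicit. Unset Printing Implicit Defensive.
Local Open Scope ring_scope.

(* A binary linear code of length N encoding n information bits is given by a
   generator matrix G over F_2: the information word x : 'rV_n is encoded as
   the codeword x *m G : 'rV_N. *)

Definition recoverable (n N : nat) (G : 'M['F_2]_(n, N)) (i : 'I_n)
    (S : {set 'I_N}) : Prop :=
  forall x y : 'rV['F_2]_n,
    (forall r : 'I_N, r \in S -> (x *m G) ord0 r = (y *m G) ord0 r) ->
    x ord0 i = y ord0 i.

(* k-batch property: for every multiset {i_1,...,i_k} of indices (given as a
   map 'I_k -> 'I_n), there are k mutually disjoint sets R_1..R_k of codeword
   positions such that x_{i_j} is a function of the bits indexed by R_j. *)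
Definition is_batch_code (n N : nat) (G : 'M['F_2]_(n, N)) (k : nat) : Prop :=
  forall idx : 'I_k -> 'I_n,
    exists R : 'I_k -> {set 'I_N},
      (forall j j' : 'I_k, j != j' -> [disjoint R j & R j']) /\
      (forall j : 'I_k, recoverable G (idx j) (R j)).

Definition batch_code_exists (n N k : nat) : Prop :=
  exists G : 'M['F_2]_(n, N), is_batch_code G k.

Definition eventually (P : nat -> Prop) : Prop :=
  exists n0 : nat, forall n : nat, (n0 <= n)%coq_nat -> P n.

Definition log2 (x : R) : R := Rdiv (ln x) (ln (INR 2)).

(* Main.v *)
Require Import Defs.
From Stdlib Require Import Reals Lra ClassicalEpsilon.
From HB Require Import structures.
From mathcomp Require Import all_boot all_algebra all_field.
From mathcomp Require ring.
Set Implicit Arguments. Unset Strict Implicit. Unset Printing Implicit Defensive.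
Import GRing.Theory.

(* Let q = 2^(s+t) and consider the binary words on N points of the affine plane
   over F_q whose restriction to every non-vertical line has vanishing power
   sums of order < 2^s; a Vandermonde argument then recovers any 2^s erasures
   on such a line. Since 1 - z^(q-1) is the indicator of the line z = 0,
   these conditions follow from orthogonality to the monomials occurring in
   x^j z^(q-1) = x^j z^(2^s-1) \prod_(i < t) z^(2^(s+i)) with
   z = y + c x + d; by additivity of Frobenius the last t factors
   give 3^t monomials in all, so 2 * 4^s * 3^t checks over F_q suffice,
   i.e. a fraction (s+t) (3/4)^t of q^2 up to constants.
   Distinct slopes are assigned to the 2^s requests: two of the lines meet in
   at most one point, so each line loses at most 2^s points, its request
   included, when the intersections are discarded. For exponents at least 1/2,
   take several copies of a code with 2^s about sqrt n up to logarithms. *)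

Section Codes.
Import ring.
Local Open Scope ring_scope.

Lemma systematic_subcode (K : fieldType) (n N M : nat) (H : 'M[K]_(N, M)) :
  (n + M <= N)%N ->
  exists (G : 'M[K]_(n, N)) (h : 'I_n -> 'I_N),
    G *m H = 0 /\ (forall (x : 'rV_n) i, (x *m G) ord0 (h i) = x ord0 i).
Proof.
move=> leN.
have len : (n <= \rank (kermx H))%N.
  by rewrite mxrank_ker leq_subRL ?rank_leq_row // (leq_trans _ leN) // addnC leq_add2l rank_leq_col.
pose A := rowsub (widen_ord len) (row_base (kermx H)).
have AH : A *m H = 0.
  rewrite mul_rowsub_mx.
  suff -> : row_base (kermx H) *m H = 0 by apply/matrixP=> i j; rewrite !mxE.
  by apply/sub_kermxP; rewrite eq_row_base.
have Afree : row_free A.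
  have := row_base_free (kermx H); rewrite /A.
  move/row_freeP=> [B HB]; apply/row_freeP; exists (colsub (widen_ord len) B).
  rewrite mul_rowsub_mx mulmx_colsub HB.
  by apply/matrixP=> i j; rewrite !mxE -val_eqE /= -val_eqE.
have Tfull : row_full A^T by rewrite /row_full mxrank_tr.
pose h := fullrankfun Tfull.
pose B := colsub h A.
have Bu : B \in unitmx.
  by rewrite -unitmx_tr trmx_mxsub; apply: fullrowsub_unit.
exists (invmx B *m A), h; split; first by rewrite -mulmxA AH mulmx0.
move=> x i.
have E : colsub h (x *m (invmx B *m A)) = x.
  by rewrite -!mulmx_colsub -/B mulVmx // mulmx1.
by rewrite -[in RHS]E [RHS]mxE.
Qed.

Lemma batch_of_parity_checks (n N M k : nat) (H : 'M['F_2]_(N, M)) :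
  (n + M <= N)%N ->
  (forall idx : 'I_k -> 'I_N, exists R : 'I_k -> {set 'I_N},
     (forall j j', j != j' -> [disjoint R j & R j']) /\
     (forall j (f : 'rV_N), f *m H = 0 ->
        (forall i, i \in R j -> f ord0 i = 0) -> f ord0 (idx j) = 0)) ->
  batch_code_exists n N k.
Proof.
move=> leN recover.
have [G [h [GH Gh]]] := systematic_subcode H leN.
exists G => idx; have [R [Rdisj Rrec]] := recover (h \o idx).
have subE m (u v : 'rV['F_2]_m) i : (u - v) ord0 i = u ord0 i - v ord0 i.
  by rewrite !mxE.
exists R; split=> // j x y eqxy; apply/eqP; rewrite -subr_eq0 -subE -Gh.
apply/eqP/(Rrec j); first by rewrite -mulmxA GH mulmx0.
by move=> i /eqxy exy; rewrite mulmxBl subE exy subrr.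
Qed.

Lemma batch_code_le (n N k k' : nat) :
  (k' <= k)%N -> batch_code_exists n N k -> batch_code_exists n N k'.
Proof.
case: k' => [|k'] lek [G Gk]; exists G => idx.
  by exists (fun=> set0); split=> -[].
have [R [Rdisj Rrec]] := Gk (fun j => idx (inord (minn j k'))).
exists (fun j => R (widen_ord lek j)); split=> [j j' neq|j].
  by apply: Rdisj; rewrite -val_eqE.
have := Rrec (widen_ord lek j).
by rewrite /= (minn_idPl _) ?inord_val // -ltnS.
Qed.

Lemma batch_code_add (n N1 N2 k1 k2 : nat) :
  batch_code_exists n N1 k1 -> batch_code_exists n N2 k2 ->
  batch_code_exists n (N1 + N2) (k1 + k2).
Proof.
move=> [G1 H1] [G2 H2]; exists (row_mx G1 G2) => idx.
have [R1 [D1 S1]] := H1 (fun j => idx (lshift k2 j)).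
have [R2 [D2 S2]] := H2 (fun j => idx (rshift k1 j)).
pose R j := match split j with
            | inl a => [set lshift N2 i | i in R1 a]
            | inr b => [set rshift N1 i | i in R2 b] end.
exists R; split=> [j j'|j].
  rewrite /R; case: (splitP j) => a Ea; case: (splitP j') => b Eb neq.
  - rewrite imset_disjoint; last exact: lshift_inj.
    by apply: D1; apply: contra neq => /eqP e; rewrite -val_eqE /= Ea Eb e.
  - apply/pred0P=> i /=; apply/negbTE/negP=> /andP[/imsetP[u _ ->] /imsetP[v _]].
    by move/eqP; rewrite eq_lrshift.
  - apply/pred0P=> i /=; apply/negbTE/negP=> /andP[/imsetP[u _ ->] /imsetP[v _]].
    by move/eqP; rewrite eq_rlshift.
  - rewrite imset_disjoint; last exact: rshift_inj.
    by apply: D2; apply: contra neq => /eqP e; rewrite -val_eqE /= Ea Eb e.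
move=> x y; rewrite !mul_mx_row /R; case: (splitP j) => a Ea eqxy.
  have -> : j = lshift k2 a by apply: val_inj.
  apply: S1 => r rR; have := eqxy (lshift N2 r).
  by rewrite !row_mxEl; apply; rewrite imset_f.
have -> : j = rshift k1 a by apply: val_inj.
apply: S2 => r rR; have := eqxy (rshift N1 r).
by rewrite !row_mxEr; apply; rewrite imset_f.
Qed.

Lemma batch_code_mul (n N k u : nat) :
  batch_code_exists n N k -> batch_code_exists n (u * N) (u * k).
Proof.
move=> H; elim: u => [|u IHu]; last by rewrite !mulSn; apply: batch_code_add.
by exists 0 => idx; exists (fun=> set0); split=> -[].
Qed.

Lemma char2_field (l : nat) : (0 < l)%N ->
  exists (F : finFieldType) (bits : {additive F -> 'rV['F_2]_l}),
    [/\ 2%N \in [pchar F], #|F| = (2 ^ l)%N & injective bits].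
Proof.
move=> l0; have [F chF cF] := pPrimePowerField (isT : prime 2) l0.
have dl : logn 2 #|pPrimeCharType chF| = l by rewrite /= cF pfactorK.
have [b blin bbij] := pprimeChar_vectAxiom chF; rewrite dl in b blin bbij.
pose Bl := GRing.isLinear.Build _ _ _ _ b blin.
pose bl : {linear pPrimeCharType chF -> 'rV['F_2]_l} := HB.pack b Bl.
exists F, (bl : {additive pPrimeCharType chF -> _}).
by split=> //; apply: bij_inj bbij.
Qed.

Lemma parity_check_matrix (F : finFieldType) (l N : nat)
    (bits : {additive F -> 'rV['F_2]_l}) (I : finType) (phi : I -> 'I_N -> F) :
  injective bits ->
  exists H : 'M['F_2]_(N, #|I| * l), forall f : 'rV_N, f *m H = 0 ->
    forall a, \sum_i phi a i *+ (f ord0 i : nat) = 0.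
Proof.
move=> bits_inj.
pose B i : 'M_(#|I|, l) := \matrix_a bits (phi (enum_val a) i).
exists (\matrix_i mxvec (B i)) => f fH a.
apply: bits_inj; rewrite raddf0 raddf_sum /=.
have : vec_mx (f *m \matrix_i mxvec (B i)) = 0 by rewrite fH raddf0.
rewrite mulmx_sum_row raddf_sum /= => /(congr1 (row (enum_rank a))).
rewrite raddf0 raddf_sum => E; rewrite -[RHS]E; apply: eq_bigr => i _ /=.
rewrite rowK linearZ /= linearZ /= mxvecK rowK enum_rankK raddfMn.
by rewrite -scaler_nat natr_Zp.
Qed.

Section LiftedLines.
Variables (F : finFieldType) (s t N : nat) (pt : 'I_N -> F * F).
Hypotheses (chF : 2%N \in [pchar F]) (cardF : #|F| = (2 ^ (s + t))%N).
Hypotheses (pt_inj : injective pt) (st_gt0 : (0 < s + t)%N).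

(* The index [2] picks the default [1]. *)
Definition monomial (u : 'I_3) (x y : F) : F := nth 1 [:: x; y] u.

Definition check (A b : nat) (g : {ffun 'I_t -> 'I_3}) (x y : F) : F :=
  x ^+ A * y ^+ b * \prod_i monomial (g i) x y ^+ (2 ^ (s + i)).

Definition on_line (c d : F) (i : 'I_N) : bool :=
  (pt i).2 + (c * (pt i).1 + d) == 0.

Lemma on_line_fst_inj c d i i' :
  on_line c d i -> on_line c d i' -> (pt i).1 = (pt i').1 -> i = i'.
Proof.
move=> /eqP Li /eqP Li' e; apply: pt_inj; rewrite [LHS]surjective_pairing [RHS]surjective_pairing.
by congr (_, _) => //; apply: (addIr (c * (pt i).1 + d)); rewrite Li e Li'.
Qed.

Section Codeword.
Variable f : 'rV['F_2]_N.

Definition orthogonal_to (P : F -> F -> F) : Prop :=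
  \sum_i P (pt i).1 (pt i).2 *+ (f ord0 i : nat) = 0.

Lemma orthogonal_to_eq P Q :
  (forall x y, P x y = Q x y) -> orthogonal_to Q -> orthogonal_to P.
Proof. by move=> PQ; rewrite /orthogonal_to; under eq_bigr do rewrite -PQ. Qed.

Lemma orthogonal_to_scale k P :
  orthogonal_to P -> orthogonal_to (fun x y => k * P x y).
Proof.
rewrite /orthogonal_to => P0; under eq_bigr do rewrite -mulrnAr.
by rewrite -mulr_sumr P0 mulr0.
Qed.

Lemma orthogonal_to_sum (I : Type) (r : seq I) (C : pred I) P :
  (forall i, C i -> orthogonal_to (P i)) ->
  orthogonal_to (fun x y => \sum_(i <- r | C i) P i x y).
Proof.
rewrite /orthogonal_to => P0; under eq_bigr do rewrite -sumrMnl.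
by rewrite exchange_big /= big1.
Qed.

Hypothesis checks_f : forall A b g,
  (A < 2 * 2 ^ s)%N -> (b < 2 ^ s)%N -> orthogonal_to (check A b g).

Lemma expr_2expM1 (z : F) :
  z ^+ (2 ^ (s + t)).-1 = z ^+ (2 ^ s).-1 * \prod_(i < t) z ^+ (2 ^ (s + i)).
Proof.
elim: t => [|t' IH]; first by rewrite addn0 big_ord0 mulr1.
rewrite big_ord_recr /= mulrA -IH -exprD addnS expnS mul2n -addnn.
by rewrite -(prednK (expn_gt0 2 (s + t'))).
Qed.

Lemma expr_2exp_line (c d x y : F) m :
  (y + (c * x + d)) ^+ (2 ^ m) =
  \sum_(u < 3) nth (d ^+ (2 ^ m)) [:: c ^+ (2 ^ m); 1] u * monomial u x y ^+ (2 ^ m).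
Proof.
have nat2 : [pchar F].-nat (2 ^ m)%N by rewrite pnatX pnatE ?chF.
rewrite !exprDn_pchar // exprMn !big_ord_recl big_ord0 /monomial /= expr1n.
by rewrite mul1r mulr1 addr0 [RHS]addrCA.
Qed.

Lemma orthogonal_to_line_power c d j : (j < 2 ^ s)%N ->
  orthogonal_to (fun x y => x ^+ j * (y + (c * x + d)) ^+ (2 ^ (s + t)).-1).
Proof.
move=> lej.
pose w i (u : 'I_3) := nth (d ^+ (2 ^ (s + i))) [:: c ^+ (2 ^ (s + i)); 1] u.
pose m b := ((2 ^ s).-1 - b)%N.
have E x y : x ^+ j * (y + (c * x + d)) ^+ (2 ^ (s + t)).-1 =
  \sum_(b < (2 ^ s).-1.+1) \sum_(a < (m b).+1) \sum_(g : {ffun 'I_t -> 'I_3})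
    (c ^+ (m b - a) * d ^+ a * ('C(m b, a) * 'C((2 ^ s).-1, b))%:R * \prod_(i < t) w i (g i))
    * check (j + (m b - a)) b g x y.
  rewrite expr_2expM1.
  under [\prod_(i < t) _]eq_bigr do rewrite expr_2exp_line.
  rewrite bigA_distr_bigA /= [y + _]addrC exprDn.
  rewrite mulr_suml mulr_sumr; apply: eq_bigr => b _.
  rewrite exprDn mulr_suml -sumrMnl mulr_suml mulr_sumr; apply: eq_bigr => a _.
  rewrite !mulr_sumr; apply: eq_bigr => g _.
  rewrite big_split /= /check (exprMn (m b - a)) (exprD x j) natrM.
  rewrite -[_ *+ 'C(_, a)]mulr_natr -[_ *+ 'C(_, b)]mulr_natr.
  move: (c ^+ _) (d ^+ _) (x ^+ (_ - _)) (x ^+ j) (y ^+ b) (_%:R) (_%:R).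
  by move: (\prod_i _) (\prod_i _) => *; ring.
apply: (orthogonal_to_eq E).
apply: orthogonal_to_sum => b _; apply: orthogonal_to_sum => a _.
apply: orthogonal_to_sum => g _; apply: orthogonal_to_scale; apply: checks_f.
  rewrite mul2n -addnn -addSn leq_add // (leq_trans (leq_subr _ _)) //.
  by rewrite (leq_trans (leq_subr _ _)) // leq_pred.
by rewrite -[X in (_ < X)%N](prednK (expn_gt0 2 s)).
Qed.

Lemma orthogonal_to_line c d (p : {poly F}) : (size p <= 2 ^ s)%N ->
  \sum_(i | on_line c d i) p.[(pt i).1] *+ (f ord0 i : nat) = 0.
Proof.
move=> szp; rewrite big_mkcond /=.
pose z x y := y + (c * x + d).
suff : orthogonal_to (fun x y => p.[x] * (1 - z x y ^+ (2 ^ (s + t)).-1)).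
  rewrite /orthogonal_to => E; rewrite -[RHS]E; apply: eq_bigr => i _.
  rewrite /on_line -/(z _ _); have [->|nz] := eqVneq (z _ _) 0.
    rewrite expr0n; have -> : ((2 ^ (s + t)).-1 == 0)%N = false.
      by case: (s + t)%N st_gt0 => // n _; rewrite expnS mul2n; case: (2 ^ n)%N (expn_gt0 2 n).
    by rewrite subr0 mulr1.
  suff -> : z (pt i).1 (pt i).2 ^+ (2 ^ (s + t)).-1 = 1.
    by rewrite subrr mulr0 mul0rn.
  apply: (mulfI nz); rewrite -exprS prednK ?expn_gt0 // mulr1 -cardF.
  exact: expf_card.
have E x y : p.[x] * (1 - z x y ^+ (2 ^ (s + t)).-1) = \sum_(j < 2 ^ s)
  p`_j * (\sum_(e : bool) (-1) ^+ e * (if e then x ^+ j * z x y ^+ (2 ^ (s + t)).-1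
          else check j 0 [ffun=> inord 2] x y)).
  rewrite (horner_coef_wide _ szp) mulr_suml; apply: eq_bigr => j _.
  rewrite big_bool /= /check big1 ?mulr1 ?expr0 ?expr1; last first.
    by move=> i _; rewrite ffunE /monomial inordK // expr1n.
  by rewrite mul1r mulN1r addrC -mulrA mulrBr !mulr1.
apply: (orthogonal_to_eq E).
apply: orthogonal_to_sum => j _; apply: orthogonal_to_scale.
apply: orthogonal_to_sum => -[] _; apply: orthogonal_to_scale.
  exact: orthogonal_to_line_power.
by apply: checks_f; rewrite ?expn_gt0 // (leq_trans (ltn_ord j)) // leq_pmull.
Qed.

Lemma line_erasures c d (D : {set 'I_N}) i0 :
  (#|D| <= 2 ^ s)%N -> (forall i, i \in D -> on_line c d i) ->
  (forall i, on_line c d i -> i \notin D -> f ord0 i = 0) ->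
  i0 \in D -> f ord0 i0 = 0.
Proof.
move=> szD DL f0 Di0; apply/eqP; apply: contraT => nz.
pose p : {poly F} := \prod_(i in D :\ i0) ('X - ((pt i).1)%:P).
have szp : (size p <= 2 ^ s)%N.
  rewrite /p -big_enum size_prod_XsubC -cardE; apply: leq_trans szD.
  by rewrite (cardsD1 i0 D) Di0.
have := orthogonal_to_line c d szp.
rewrite (bigD1 i0) ?DL //= big1 ?addr0 => [|i /andP[Li ni]]; last first.
  have [Di|nD] := boolP (i \in D); last by rewrite f0 // mulr0n.
  rewrite horner_prod (bigD1 i) /= ?hornerXsubC ?subrr ?mul0r ?mul0rn //.
  by rewrite !inE ni.
have -> : (f ord0 i0 : nat) = 1%N.
  by move: nz; case: (f ord0 i0) => -[|[|?]] // ?; rewrite -val_eqE.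
move/eqP; rewrite mulr1n horner_prod prodf_seq_eq0 => /hasP[i _] /andP[].
rewrite !inE => /andP[ni Di]; rewrite hornerXsubC subr_eq0 => /eqP e.
by case/eqP: ni; apply: on_line_fst_inj (DL _ Di) (DL _ Di0) _.
Qed.

End Codeword.

End LiftedLines.

Lemma batch_lifted_code (s t n N : nat) :
  (0 < s + t)%N ->
  (n + 2 * 2 ^ s * 2 ^ s * 3 ^ t * (s + t) <= N)%N -> (N <= 4 ^ (s + t))%N ->
  batch_code_exists n N (2 ^ s).
Proof.
move=> st0 leN Nle; have [F [bits [chF cF bits_inj]]] := char2_field st0.
have NF : (N <= #|{: F * F}|)%N by rewrite card_prod cF -expnMn.
pose pt (i : 'I_N) : F * F := enum_val (widen_ord NF i).
have pt_inj : injective pt by move=> i j /enum_val_inj /(congr1 val) /= /val_inj.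
pose I : finType := ('I_(2 * 2 ^ s) * 'I_(2 ^ s) * {ffun 'I_t -> 'I_3})%type.
have cI : #|I| = (2 * 2 ^ s * 2 ^ s * 3 ^ t)%N by rewrite !card_prod card_ffun !card_ord.
have [H Hchk] := parity_check_matrix (fun (a : I) i =>
  check s a.1.1 a.1.2 a.2 (pt i).1 (pt i).2) bits_inj.
apply: (batch_of_parity_checks (H := H)) => [|idx]; first by rewrite cI.
have kF : (2 ^ s <= #|F|)%N by rewrite cF leq_exp2l // leq_addr.
pose c (j : 'I_(2 ^ s)) : F := enum_val (widen_ord kF j).
have c_inj : injective c by move=> i j /enum_val_inj /(congr1 val) /= /val_inj.
pose d j := - ((pt (idx j)).2 + c j * (pt (idx j)).1).
pose L j := [set i | on_line pt (c j) (d j) i].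
pose D j := idx j |: \bigcup_(j' | j' != j) (L j :&: L j').
have Lidx j : on_line pt (c j) (d j) (idx j).
  by rewrite /on_line /d addrA subrr.
have cardLL j j' : j' != j -> (#|L j :&: L j'| <= 1)%N.
  move=> neq; apply/card_le1_eqP => i' i; rewrite !inE => /andP[Li' L'i'] /andP[Li L'i].
  apply: (on_line_fst_inj pt_inj Li Li').
  have nz : c j - c j' != 0 by rewrite subr_eq0 (inj_eq c_inj) eq_sym.
  have slope u v : v + (c j * u + d j) = 0 -> v + (c j' * u + d j') = 0 ->
      (c j - c j') * u = d j' - d j.
    move=> e e'; apply/eqP; rewrite -subr_eq0.
    suff -> : (c j - c j') * u - (d j' - d j) =
        (v + (c j * u + d j)) - (v + (c j' * u + d j')) by rewrite e e' subrr.
    ring.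
  by apply: (mulfI nz); rewrite (slope _ _ (eqP Li) (eqP L'i)) (slope _ _ (eqP Li') (eqP L'i')).
have cardD j : (#|D j| <= 2 ^ s)%N.
  rewrite (leq_trans (leq_card_setU _ _)) // cards1 add1n.
  have : (#|\bigcup_(j' | j' != j) (L j :&: L j')| <= \sum_(j' | j' != j) 1)%N.
    elim/big_rec2: _ => [|j' A m neq IH]; first by rewrite cards0.
    by rewrite (leq_trans (leq_card_setU _ _)) // leq_add ?cardLL.
  by rewrite sum1_card cardC1 card_ord -ltnS prednK ?expn_gt0.
exists (fun j => L j :\: D j); split=> [j j' neq|j f fH fR].
  apply/pred0P=> i /=; apply/negbTE/negP; rewrite !inE => /andP[/andP[nD Lj] /andP[_ Lj']].
  case/negP: nD; apply/orP; right; apply/bigcupP; exists j'; first by rewrite eq_sym.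
  by rewrite !inE Lj.
apply: (@line_erasures F s t N pt chF cF pt_inj st0 f _ (c j) (d j) (D j)) => //.
- move=> A b g ltA ltb; rewrite /orthogonal_to.
  exact: (Hchk f fH (Ordinal ltA, Ordinal ltb, g)).
- move=> i; rewrite !inE => /orP[/eqP->//|/bigcupP[j' _]].
  by rewrite !inE => /andP[].
- by move=> i Li nD; apply: fR; rewrite in_setD nD inE.
- by rewrite !inE eqxx.
Qed.

End Codes.

(* MathComp's algebra rebinds the key %R to [ring_scope]. *)
Delimit Scope R_scope with R.

Section Asymptotics.
Local Open Scope R_scope.

Lemma eventually_and P Q : eventually P -> eventually Q -> eventually (fun n => P n /\ Q n).
Proof.
move=> [a Pa] [b Qb]; exists (Nat.max a b) => n /Nat.max_lub_iff[an bn].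
by split; [apply: Pa | apply: Qb].
Qed.

Lemma eventually_impl (P Q : nat -> Prop) :
  eventually P -> (forall n, P n -> Q n) -> eventually Q.
Proof. by move=> [a Pa] PQ; exists a => n /Pa /PQ. Qed.

Lemma natfloor (y : R) : 0 <= y -> exists k : nat, INR k <= y < INR k + 1.
Proof.
move=> y0; have [lo hi] := base_Int_part y.
exists (Z.to_nat (Int_part y)); rewrite INR_IZR_INZ Znat.Z2Nat.id; first lra.
have : Z.lt (-1) (Int_part y) by apply: lt_IZR; lra.
by move/Zorder.Zlt_le_succ.
Qed.

Lemma eventually_INR_ge (C : R) : eventually (fun n => C <= INR n).
Proof.
have [k [_ hk]] := natfloor (Rmax_l 0 C).
exists k.+1 => n /le_INR; rewrite S_INR; have := Rmax_r 0 C; lra.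
Qed.

Lemma eventually_Rpower_ge (C d : R) : 0 < d -> eventually (fun n => C <= Rpower (INR n) d).
Proof.
move=> d0; pose C' := Rmax 1 C.
have C'1 : 1 <= C' by apply: Rmax_l.
apply: (eventually_impl (eventually_INR_ge (Rpower C' (/ d)))) => n le.
apply: (Rle_trans _ C'); first exact: Rmax_r.
rewrite -[X in X <= _](Rpower_1 C'); last lra.
rewrite -(Rinv_l d); last lra.
rewrite -Rpower_mult; apply: Rle_Rpower_l; first lra.
by split=> //; apply: exp_pos.
Qed.

Lemma Rpower_gt0 x a : 0 < Rpower x a.
Proof. exact: exp_pos. Qed.

Lemma ln_le_Rpower (x d : R) : 0 < d -> ln x <= / d * Rpower x d.
Proof.
move=> d0; apply: (Rmult_le_reg_l d) => //; rewrite -Rmult_assoc Rinv_r ?Rmult_1_l; last lra.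
have := exp_ineq1_le (d * ln x); rewrite /Rpower; lra.
Qed.

Lemma pow_between (b y : R) : 1 < b -> 1 <= y -> exists s : nat, y <= b ^ s <= b * y.
Proof.
move=> b1 y1.
have [m hm] : exists m : nat, y <= b ^ m.
  have b1' : Rabs b > 1 by rewrite Rabs_pos_eq; lra.
  have [m hm] := Pow_x_infinity b b1' y.
  exists m; have := hm m (le_n m); rewrite Rabs_pos_eq; first lra.
  by apply: pow_le; lra.
elim: m hm => [|m IH] /= hm; first by exists 0%nat => /=; split; nra.
case: (Rle_or_lt y (b ^ m)) => [/IH //|lt].
by exists m.+1 => /=; split=> //; nra.
Qed.

Lemma INR_expn (a b : nat) : INR (expn a b) = INR a ^ b.
Proof. by elim: b => [|b IH] //; rewrite expnS mult_INR IH. Qed.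

Lemma lifted_code_params (n l t : nat) : (0 < l)%coq_nat -> (t <= l)%coq_nat ->
  INR n + 2 * INR l * (3 / 4) ^ t * 4 ^ l <= 4 ^ l ->
  exists N k : nat, batch_code_exists n N k /\ 2 ^ l = INR k * 2 ^ t /\
    INR N = INR n + 2 * INR l * (3 / 4) ^ t * 4 ^ l.
Proof.
move=> l0 tl le; pose s := subn l t.
have Es : l = addn s t by rewrite /s subnK //; apply/leP.
pose N := addn n (2 * 2 ^ s * 2 ^ s * 3 ^ t * (s + t))%nat.
have EN : INR N = INR n + 2 * INR l * (3 / 4) ^ t * 4 ^ l.
  have e3 : (3 / 4) ^ t * 4 ^ t = INR 3 ^ t.
    by rewrite -Rpow_mult_distr; congr pow; rewrite /=; lra.
  have e4 : 4 ^ s = INR 2 ^ s * INR 2 ^ s.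
    by rewrite -Rpow_mult_distr; congr pow; rewrite /=; lra.
  have e2 : INR 2 = 2 by [].
  rewrite /N -Es plus_INR !mult_INR !INR_expn [in 4 ^ l]Es pow_add -e3 e4 e2; ring.
exists N, (expn 2 s); split; last split=> //.
  apply: (@batch_lifted_code s t n N); [by rewrite -Es; apply/ltP | exact: leqnn |].
  rewrite -Es; apply/leP/INR_le; rewrite EN INR_expn.
  by have -> : INR 4 = 4 by rewrite /=; lra.
by rewrite INR_expn Es pow_add.
Qed.

Lemma batch_code_le_INR (n N k k' : nat) :
  INR k' <= INR k -> batch_code_exists n N k -> batch_code_exists n N k'.
Proof. by move=> /INR_le/leP; apply: batch_code_le. Qed.

Lemma Rpower_1_le x a : 1 <= x -> 0 <= a -> 1 <= Rpower x a.
Proof. by move=> x1 a0; rewrite -(Rpower_O x); [apply: Rle_Rpower | lra]. Qed.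

Lemma pow4_sqr l : 4 ^ l = 2 ^ l * 2 ^ l.
Proof. by rewrite -Rpow_mult_distr; congr pow; lra. Qed.

Lemma pow_Rpower (b c : R) (t : nat) : 0 < b -> 0 < c -> ln b <> 0 ->
  c ^ t = Rpower (b ^ t) (ln c / ln b).
Proof.
move=> b0 c0 lnb; rewrite -!Rpower_pow // Rpower_mult /Rpower; congr exp.
by field.
Qed.

(* [(3/4)^t] decays strictly faster than [2^(-t/3)]; the slack absorbs the
   logarithmic factor in the redundancy. *)
Lemma ln2_lt_3ln43 : ln 2 < 3 * ln (4 / 3).
Proof.
have -> : 3 * ln (4 / 3) = ln (4 / 3 * (4 / 3 * (4 / 3))) by rewrite !ln_mult; lra.
by apply: ln_increasing; lra.
Qed.

Lemma codes_below_half (eps : R) : 0 < eps < 1 / 2 ->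
  exists C : R, 0 < C /\ eventually (fun n => exists N k : nat,
    batch_code_exists n N k /\ Rpower (INR n) eps <= INR k /\
    INR N - INR n <= C * Rpower (INR n) (5 / 6 + eps / 3)).
Proof.
move=> [eps0 eps2].
pose alpha := 1 / 2 - eps; have al0 : 0 < alpha by rewrite /alpha; lra.
have ln2 := ln_lt_2.
pose kap := ln (4 / 3) / ln 2.
have kapE : kap * ln 2 = ln (4 / 3) by rewrite /kap; field; lra.
have kap3 : 1 / 3 < kap by have := ln2_lt_3ln43; nra.
pose del := alpha * (kap - 1 / 3).
have del0 : 0 < del by rewrite /del; nra.
pose K := / ln 2 * (/ del * Rpower 8 del).
have K0 : 0 < K.
  by do 2! (apply: Rmult_lt_0_compat; first by apply: Rinv_0_lt_compat; lra); apply: Rpower_gt0.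
pose C := 64 / 3 * K; have C0 : 0 < C by rewrite /C; lra.
have al3 : 0 < alpha / 3 by lra.
exists C; split=> //.
have ev := eventually_and (eventually_INR_ge 1)
  (eventually_and (eventually_Rpower_ge 4 al0) (eventually_Rpower_ge C al3)).
apply: (eventually_impl ev) => n; set x := INR n => -[x1 [a4 zC]].
have [l [l1 l2]] : exists l : nat, 2 * x <= 4 ^ l <= 4 * (2 * x) by apply: pow_between; lra.
have p1 : 1 <= Rpower x eps by apply: Rpower_1_le; lra.
have [s [s1 s2]] : exists s : nat, Rpower x eps <= 2 ^ s <= 2 * Rpower x eps.
  by apply: pow_between; lra.
have xE : x = (Rpower x eps * Rpower x alpha) * (Rpower x eps * Rpower x alpha).
  rewrite -!Rpower_plus (_ : _ + _ = 1) ?Rpower_1 //; first lra.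
  by rewrite /alpha; lra.
have l0 : (0 < l)%coq_nat.
  by case: l l1 {l2} => [|l] /=; [lra | move=> _; apply/ltP].
have sl : (s <= l)%coq_nat.
  case: (Nat.le_gt_cases s l) => // ls; exfalso.
  have : 2 ^ l <= 2 ^ s by apply: Rle_pow; [lra | apply: Nat.lt_le_incl].
  have := pow_lt 2 l ltac:(lra); rewrite pow4_sqr in l1 => u0 us.
  have lt : 2 ^ l < Rpower x eps * Rpower x alpha by nra.
  by move: (Rmult_le_0_lt_compat _ _ _ _ (Rlt_le _ _ u0) (Rlt_le _ _ u0) lt lt); lra.
pose t := (l - s)%coq_nat.
have El : 2 ^ l = 2 ^ s * 2 ^ t by rewrite -pow_add /t Nat.add_comm Nat.sub_add.
have t2 : Rpower x alpha / 2 <= 2 ^ t.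
  apply: Rnot_lt_le => lt; have := pow_lt 2 t ltac:(lra) => t0.
  have : 2 ^ l < Rpower x eps * Rpower x alpha by rewrite El; have := Rpower_gt0 x alpha; nra.
  have := pow_lt 2 l ltac:(lra); rewrite pow4_sqr in l1 => /Rlt_le u0 lt'.
  by move: (Rmult_le_0_lt_compat _ _ _ _ u0 u0 lt' lt'); lra.
have q1 : (3 / 4) ^ t * Rpower x (alpha * kap) <= 4 / 3.
  have q0 : 0 < (3 / 4) ^ t by apply: pow_lt; lra.
  have qq : (3 / 4) ^ t * (4 / 3) ^ t = 1.
    by rewrite -Rpow_mult_distr (_ : 3 / 4 * (4 / 3) = 1) ?pow1 //; lra.
  suff : 3 / 4 * Rpower x (alpha * kap) <= (4 / 3) ^ t by nra.
  have -> : 3 / 4 * Rpower x (alpha * kap) = Rpower (Rpower x alpha / 2) kap.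
    rewrite -Rpower_mult /Rdiv -Rpower_mult_distr; [|exact: Rpower_gt0|lra].
    rewrite Rmult_comm; congr (_ * _).
    rewrite /Rpower ln_Rinv; last lra.
    rewrite Ropp_mult_distr_r_reverse kapE exp_Ropp exp_ln; lra.
  rewrite (@pow_Rpower 2); [|lra..]; rewrite -/kap.
  by apply: Rle_Rpower_l; [lra | split=> //; have := Rpower_gt0 x alpha; lra].
have lK : INR l <= K * Rpower x del.
  apply: (Rmult_le_reg_l (ln 2)); first lra.
  have -> : ln 2 * (K * Rpower x del) = / del * Rpower (8 * x) del.
    rewrite -Rpower_mult_distr; [|lra..].
    by rewrite /K; field; lra.
  rewrite Rmult_comm -ln_pow; last lra.
  apply: (Rle_trans _ _ _ (ln_le_Rpower _ del0)).
  apply: Rmult_le_compat_l; first by apply/Rlt_le/Rinv_0_lt_compat.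
  apply: Rle_Rpower_l; first lra.
  split; first by apply: pow_lt; lra.
  have : 1 <= 2 ^ l by apply: pow_R1_Rle; lra.
  by rewrite pow4_sqr in l2; nra.
pose R := 2 * INR l * (3 / 4) ^ t * 4 ^ l.
have Rle : R * Rpower x (alpha / 3) <= C * x.
  have XE : Rpower x (alpha * kap) = Rpower x del * Rpower x (alpha / 3).
    by rewrite -Rpower_plus; congr Rpower; rewrite /del; field.
  rewrite XE in q1.
  have q0 : 0 < (3 / 4) ^ t by apply: pow_lt; lra.
  have Y0 := Rpower_gt0 x del; have Z0 := Rpower_gt0 x (alpha / 3).
  have f0 : 0 < 4 ^ l by apply: pow_lt; lra.
  have E1 : R * Rpower x (alpha / 3) <=
      2 * (K * Rpower x del) * (3 / 4) ^ t * 4 ^ l * Rpower x (alpha / 3).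
    by rewrite /R; do 3! (apply: Rmult_le_compat_r; first lra); lra.
  apply: (Rle_trans _ _ _ E1).
  have -> : 2 * (K * Rpower x del) * (3 / 4) ^ t * 4 ^ l * Rpower x (alpha / 3) =
    2 * K * 4 ^ l * ((3 / 4) ^ t * (Rpower x del * Rpower x (alpha / 3))) by ring.
  apply: (Rle_trans _ (2 * K * 4 ^ l * (4 / 3))).
    by apply: Rmult_le_compat_l => //; nra.
  by rewrite /C; nra.
have [|N [k [Hb [kE NE]]]] := lifted_code_params (n := n) l0 (Nat.le_sub_l l s).
  rewrite -/x -/t -/R.
  suff : R <= x by lra.
  apply: (Rmult_le_reg_r C) => //; rewrite [x * C]Rmult_comm.
  apply: Rle_trans Rle; apply: Rmult_le_compat_l => //.
  rewrite /R; have := pos_INR l; have := pow_lt (3 / 4) t ltac:(lra).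
  have := pow_lt 4 l ltac:(lra) => ? ? ?.
  by repeat apply: Rmult_le_pos; lra.
exists N, k; split=> //; split.
  move: kE; rewrite -/t El => /Rmult_eq_reg_r <- //.
  by apply: pow_nonzero; lra.
rewrite NE -/x -/t -/R.
apply: (Rmult_le_reg_r (Rpower x (alpha / 3))); first exact: Rpower_gt0.
rewrite Rmult_assoc -Rpower_plus (_ : _ + alpha / 3 = 1); last by rewrite /alpha; lra.
by rewrite Rpower_1; lra.
Qed.

Lemma ln_le_compat x y : 0 < x -> x <= y -> ln x <= ln y.
Proof.
by move=> x0 [lt|->]; [apply/Rlt_le/ln_increasing | apply: Rle_refl].
Qed.

Lemma codes_near_half : exists C : R, 0 < C /\ eventually (fun n => exists N k : nat,
  batch_code_exists n N k /\ INR N <= 2 * INR n /\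
  Rpower (INR n) (1 / 2) <= INR k * (C * ln (INR n)) ^ 3).
Proof.
have ln2 := ln_lt_2.
pose C := 64 / ln 2; have C0 : 0 < C by apply: Rdiv_lt_0_compat; lra.
exists C; split=> //.
have ev := eventually_and (eventually_INR_ge 2)
  (eventually_Rpower_ge ((C * / (1 / 12)) ^ 6) (ltac:(lra) : 0 < 1 / 2)).
apply: (eventually_impl ev) => n; set x := INR n => -[x2 h6].
have lnx : 0 < ln x by rewrite -ln_1; apply: ln_increasing; lra.
have [l [l1 l2]] : exists l : nat, 2 * x <= 4 ^ l <= 4 * (2 * x) by apply: pow_between; lra.
have l0 : (0 < l)%coq_nat.
  by case: l l1 {l2} => [|l] /=; [lra | move=> _; apply/ltP].
have lge1 : 1 <= INR l by apply: (le_INR 1).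
have lC : 32 * INR l <= C * ln x.
  have : ln (4 ^ l) <= ln (x * (x * (x * x))).
    apply: ln_le_compat; first by apply: pow_lt; lra.
    have xx : 4 <= x * x by nra.
    have xxx : 8 <= x * (x * x) by nra.
    by apply: (Rle_trans _ _ _ l2); nra.
  have l0' : 0 < 2 ^ l by apply: pow_lt; lra.
  rewrite pow4_sqr [ln (2 ^ l * _)]ln_mult // ln_pow; last lra.
  do 3! (rewrite ln_mult; [|lra|by repeat apply: Rmult_lt_0_compat; lra]).
  move=> le; apply: (Rmult_le_reg_l (ln 2)); first lra.
    have -> : ln 2 * (C * ln x) = 64 * ln x by rewrite /C; field; lra.
  lra.
have [u [u1 u2]] : exists u : nat, 16 * INR l <= 2 ^ u <= 2 * (16 * INR l).
  by apply: pow_between; lra.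
pose t := (u * 3)%coq_nat.
have tE : 2 ^ t = (2 ^ u) ^ 3 by rewrite pow_mult.
have u0 : 0 < 2 ^ u by apply: pow_lt; lra.
have tC : 2 ^ t <= (C * ln x) ^ 3 by rewrite tE; apply: pow_incr; lra.
have xE : x = Rpower x (1 / 2) * Rpower x (1 / 2).
  by rewrite -Rpower_plus (_ : 1 / 2 + 1 / 2 = 1) ?Rpower_1; lra.
have tl : (t <= l)%coq_nat.
  case: (Nat.le_gt_cases t l) => // lt; exfalso.
  have : 2 ^ l <= 2 ^ t by apply: Rle_pow; [lra | apply: Nat.lt_le_incl].
  have lnle : C * ln x <= C * / (1 / 12) * Rpower x (1 / 12).
    rewrite Rmult_assoc; apply: Rmult_le_compat_l; first lra.
    by apply: ln_le_Rpower; lra.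
  have : 0 <= C * ln x by nra.
  move=> nn lle.
  have le6 : 4 ^ l <= (C * ln x) ^ 3 * (C * ln x) ^ 3.
    rewrite pow4_sqr; have := pow_le 2 l ltac:(lra) => ?.
    by apply: Rmult_le_compat; lra.
  have := pow_incr _ _ 6 (conj nn lnle).
  rewrite [(_ * Rpower _ _) ^ 6]Rpow_mult_distr -[Rpower x _ ^ 6]Rpower_pow ?Rpower_mult; last exact: Rpower_gt0.
  have -> : 1 / 12 * INR 6 = 1 / 2 by rewrite /=; field.
  have -> : (C * ln x) ^ 6 = (C * ln x) ^ 3 * (C * ln x) ^ 3 by ring.
  by have := Rpower_gt0 x (1 / 2); nra.
pose R := 2 * INR l * (3 / 4) ^ t * 4 ^ l.
have Rx : R <= x.
  have q : (3 / 4) ^ t * 2 ^ u <= 1.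
    rewrite /t Nat.mul_comm pow_mult -Rpow_mult_distr -[X in _ <= X](pow1 u).
    by apply: pow_incr; lra.
  have q0 : 0 < (3 / 4) ^ t by apply: pow_lt; lra.
  have q16 : (3 / 4) ^ t * (16 * INR l) <= 1 by nra.
  by rewrite /R; nra.
have [|N [k [Hb [kE NE]]]] := lifted_code_params (n := n) l0 tl.
  by rewrite -/x -/R; lra.
exists N, k; split=> //; split; first by rewrite NE -/x -/R; lra.
apply: (Rle_trans _ (INR k * 2 ^ t)); last first.
  by apply: Rmult_le_compat_l => //; apply: pos_INR.
rewrite -kE; apply: Rnot_lt_le => lt.
have := pow_lt 2 l ltac:(lra) => /Rlt_le p0.
by move: (Rmult_le_0_lt_compat _ _ _ _ p0 p0 lt lt); rewrite -pow4_sqr -xE; lra.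
Qed.

Lemma eventually_choice2 (P : nat -> nat -> nat -> Prop) :
  eventually (fun n => exists N k, P n N k) ->
  exists Nf kf : nat -> nat, eventually (fun n => P n (Nf n) (kf n)).
Proof.
move=> [n0 H].
pose F n := epsilon (inhabits (0%nat, 0%nat)) (fun p => P n p.1 p.2).
exists (fun n => (F n).1), (fun n => (F n).2), n0 => n /H[N [k HP]].
by apply: (epsilon_spec _ (fun p => P n p.1 p.2)); exists (N, k).
Qed.

Lemma floor_ge_half (y : R) : 1 <= y -> exists k : nat, / 2 * y <= INR k <= 1 * y.
Proof.
move=> y1; have [|k [k1 k2]] := @natfloor y; first lra.
exists k; split; last lra.
have k0 : (0 < k)%coq_nat by apply: INR_lt; rewrite /=; lra.
by have := le_INR 1 k k0; rewrite /=; lra.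
Qed.

Lemma codes_theta_below_half (eps : R) : 0 < eps < 1 / 2 ->
  exists (C : R) (Nf kf : nat -> nat), 0 < C /\ eventually (fun n =>
    batch_code_exists n (Nf n) (kf n) /\
    (/ 2 * Rpower (INR n) eps <= INR (kf n) <= 1 * Rpower (INR n) eps) /\
    INR (Nf n) - INR n <= C * Rpower (INR n) (5 / 6 + eps / 3)).
Proof.
move=> eps_lt; have [C [C0 HC]] := codes_below_half eps_lt.
suff /eventually_choice2[Nf [kf H]] : eventually (fun n => exists N k,
    batch_code_exists n N k /\
    (/ 2 * Rpower (INR n) eps <= INR k <= 1 * Rpower (INR n) eps) /\
    INR N - INR n <= C * Rpower (INR n) (5 / 6 + eps / 3)) by exists C, Nf, kf.
apply: (eventually_impl (eventually_and HC (eventually_INR_ge 1))) => n [[N [k [HB [kge Nle]]]] n1].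
have [|k' k'E] := @floor_ge_half (Rpower (INR n) eps); first by apply: Rpower_1_le; lra.
exists N, k'; split=> //; apply: batch_code_le_INR HB; lra.
Qed.

Lemma log2_bounds : eventually (fun n => 1 <= log2 (INR n) <= INR n).
Proof.
apply: (eventually_impl (eventually_INR_ge 16)) => n n16.
have ln2 := ln_lt_2; rewrite /log2 (_ : INR 2 = 2) //.
have le2 : ln 2 <= ln (INR n) by apply: ln_le_compat; lra.
have lnE : ln (INR n) / ln 2 * ln 2 = ln (INR n) by field; lra.
split; apply: (Rmult_le_reg_r (ln 2)); try lra.
rewrite lnE.
have := @ln_le_Rpower (INR n) (1 / 2) ltac:(lra).
set h := Rpower _ _ => hl.
have hE : INR n = h * h.
  by rewrite /h -Rpower_plus (_ : 1 / 2 + 1 / 2 = 1) ?Rpower_1; lra.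
have h0 : 0 < h by apply: Rpower_gt0.
have h4 : 4 <= h by nra.
rewrite (_ : / (1 / 2) = 2) in hl; last by field.
by apply: (Rle_trans _ _ _ hl); rewrite hE; nra.
Qed.

Lemma codes_above_half (eps : R) : 1 / 2 <= eps ->
  exists kf Nf : nat -> nat,
    eventually (fun n => batch_code_exists n (Nf n) (kf n)) /\
    (exists c1 c2 : R, 0 < c1 /\ 0 < c2 /\
      eventually (fun n => c1 * Rpower (INR n) eps <= INR (kf n) /\
                           INR (kf n) <= c2 * Rpower (INR n) eps)) /\
    (forall tau : R, 0 < tau -> exists C : R, 0 < C /\
      eventually (fun n => INR (Nf n) <= C * Rpower (INR n) (1 / 2 + eps + tau))).
Proof.
move=> eps2; have [C [C0 HC]] := codes_near_half.
suff /eventually_choice2[Nf [kf H]] : eventually (fun n => exists N k,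
    batch_code_exists n N k /\
    (/ 2 * Rpower (INR n) eps <= INR k <= 1 * Rpower (INR n) eps) /\
    INR N <= (2 * (C * ln (INR n)) ^ 3 + 2) * Rpower (INR n) (1 / 2 + eps)).
  exists kf, Nf; split; first by apply: (eventually_impl H) => n [].
  split.
    exists (/ 2), 1; split; first lra; split; first lra.
    by apply: (eventually_impl H) => n [_ []].
  move=> tau tau0; have t3 : 0 < tau / 3 by lra.
  pose D := 2 * (C * / (tau / 3)) ^ 3 + 2.
  have i0 : 0 < / (tau / 3) by apply: Rinv_0_lt_compat.
  exists D; split; first by rewrite /D; have := pow_lt _ 3 (Rmult_lt_0_compat _ _ C0 i0); lra.
  apply: (eventually_impl (eventually_and H (eventually_INR_ge 1))) => n [[_ [_ le]] n1].
  apply: (Rle_trans _ _ _ le); rewrite (Rpower_plus (1 / 2 + eps)).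
  rewrite [Rpower _ (1 / 2 + eps) * _]Rmult_comm -Rmult_assoc.
  apply: Rmult_le_compat_r; first exact: Rlt_le (Rpower_gt0 _ _).
  have T1 : 1 <= Rpower (INR n) tau by apply: Rpower_1_le; lra.
  have ln0 : 0 <= ln (INR n) by rewrite -ln_1; apply: ln_le_compat; lra.
  have lnle : C * ln (INR n) <= C * / (tau / 3) * Rpower (INR n) (tau / 3).
    by rewrite Rmult_assoc; apply: Rmult_le_compat_l; [lra | apply: ln_le_Rpower].
  have := pow_incr _ _ 3 (conj (Rmult_le_pos _ _ (Rlt_le _ _ C0) ln0) lnle).
  rewrite [(_ * Rpower _ _) ^ 3]Rpow_mult_distr -[Rpower _ _ ^ 3]Rpower_pow ?Rpower_mult; last exact: Rpower_gt0.
  have -> : tau / 3 * INR 3 = tau by rewrite /=; field.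
  by rewrite /D; lra.
apply: (eventually_impl (eventually_and HC (eventually_INR_ge 1))) => n [[N [k [HB [Nle kge]]]] n1].
have E1 : 1 <= Rpower (INR n) eps by apply: Rpower_1_le; lra.
have [k' k'E] := floor_ge_half E1.
have h0 : 0 < Rpower (INR n) (1 / 2) by apply: Rpower_gt0.
have k0 : 0 < INR k.
  case: k kge {HB} => [|k] kge; first by move: kge; rewrite /= Rmult_0_l; lra.
  by apply: lt_0_INR; apply/ltP.
have [|u [u1 u2]] := @natfloor (INR k' / INR k).
  by apply: Rmult_le_pos; [apply: pos_INR | apply/Rlt_le/Rinv_0_lt_compat].
exists (muln u.+1 N), k'; split.
  apply: batch_code_le_INR (batch_code_mul u.+1 HB).
  rewrite mult_INR S_INR.
  apply: (Rmult_le_reg_r (/ INR k)); first exact: Rinv_0_lt_compat.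
  rewrite Rmult_assoc Rinv_r ?Rmult_1_r; [|lra].
  by apply: Rlt_le.
split=> //; rewrite mult_INR S_INR.
set L := (C * ln (INR n)) ^ 3 in kge *.
have uk : INR u * INR k <= Rpower (INR n) eps.
  apply: (Rle_trans _ (INR k')); last lra.
  by have -> : INR k' = INR k' / INR k * INR k; [field; lra | apply: Rmult_le_compat_r; lra].
have xE : INR n = Rpower (INR n) (1 / 2) * Rpower (INR n) (1 / 2).
  by rewrite -Rpower_plus (_ : 1 / 2 + 1 / 2 = 1) ?Rpower_1; lra.
have heps : Rpower (INR n) (1 / 2) <= Rpower (INR n) eps by apply: Rle_Rpower.
have L0 : 0 <= L.
  by apply: Rnot_lt_le => L0; nra.
rewrite Rpower_plus.
have u0 := pos_INR u.
have uh : INR u * Rpower (INR n) (1 / 2) <= Rpower (INR n) eps * L.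
  apply: (Rle_trans _ (INR u * INR k * L)); last by apply: Rmult_le_compat_r.
  by rewrite Rmult_assoc; apply: Rmult_le_compat_l.
apply: (Rle_trans _ ((INR u + 1) * (2 * INR n))); first by apply: Rmult_le_compat_l; lra.
rewrite [X in 2 * X]xE; move: (Rpower (INR n) (1 / 2)) (Rpower (INR n) eps) h0 heps uh => h e h0 heps uh.
have := Rmult_le_compat_r _ _ _ (Rlt_le _ _ h0) uh.
have := Rmult_le_compat_r _ _ _ (Rlt_le _ _ h0) heps.
lra.
Qed.

End Asymptotics.

Theorem theorem7 :
  (* main part: for 0 < alpha < 1/2 *)
  (forall alpha : R, (0 < alpha < 1/2)%R ->
    exists c1 c2 C : R, (0 < c1)%R /\ (0 < c2)%R /\ (0 < C)%R /\
      eventually (fun n => exists N k : nat,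
        batch_code_exists n N k /\
        (c1 * Rpower (INR n / log2 (INR n)) (1/2 - alpha) <= INR k)%R /\
        (INR k <= c2 * Rpower (INR n / log2 (INR n)) (1/2 - alpha))%R /\
        (INR N - INR n <= C * Rpower (INR n) (1 - alpha/3)
                              * Rpower (log2 (INR n)) (alpha/3))%R)) /\
  (* r_B(n, k = Omega(n^{eps^-})) = O(n^{delta(eps)^+}), delta = 5/6 + eps/3 *)
  (forall eps : R, (0 < eps < 1/2)%R ->
    exists kf Nf : nat -> nat,
      eventually (fun n => batch_code_exists n (Nf n) (kf n)) /\
      (forall tau : R, (0 < tau)%R -> exists c : R, (0 < c)%R /\
        eventually (fun n => (c * Rpower (INR n) (eps - tau) <= INR (kf n))%R)) /\
      (forall tau : R, (0 < tau)%R -> exists C : R, (0 < C)%R /\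
        eventually (fun n => (INR (Nf n) - INR n
                               <= C * Rpower (INR n) (5/6 + eps/3 + tau))%R))) /\
  (* r_B(n, k = Theta(n^eps)) = o(n) *)
  (forall eps : R, (0 < eps < 1/2)%R ->
    exists kf Nf : nat -> nat,
      eventually (fun n => batch_code_exists n (Nf n) (kf n)) /\
      (exists c1 c2 : R, (0 < c1)%R /\ (0 < c2)%R /\
        eventually (fun n => (c1 * Rpower (INR n) eps <= INR (kf n))%R /\
                             (INR (kf n) <= c2 * Rpower (INR n) eps)%R)) /\
      (forall eta : R, (0 < eta)%R ->
        eventually (fun n => (INR (Nf n) - INR n <= eta * INR n)%R))) /\
  (* eps >= 1/2: k = Theta(n^eps) and N = O(n^{(1/2 + eps)^+}) *)
  (forall eps : R, (1/2 <= eps)%R ->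
    exists kf Nf : nat -> nat,
      eventually (fun n => batch_code_exists n (Nf n) (kf n)) /\
      (exists c1 c2 : R, (0 < c1)%R /\ (0 < c2)%R /\
        eventually (fun n => (c1 * Rpower (INR n) eps <= INR (kf n))%R /\
                             (INR (kf n) <= c2 * Rpower (INR n) eps)%R)) /\
      (forall tau : R, (0 < tau)%R -> exists C : R, (0 < C)%R /\
        eventually (fun n => (INR (Nf n) <= C * Rpower (INR n) (1/2 + eps + tau))%R))).
Proof.
split; last split; last split.
- move=> alpha al.
  have [|C [C0 H]] := @codes_below_half (1 / 2 - alpha)%R; first by lra.
  exists (/ 2)%R, 1%R, C; split; first lra; split; first lra; split=> //.
  apply: (eventually_impl (eventually_and H log2_bounds)).
  move=> n [[N [k0 [HB [kge Nle]]]] [log1 logn]].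
  have n0 : (0 < INR n)%R by lra.
  have log0 : (0 < log2 (INR n))%R by lra.
  have ratio1 : (1 <= INR n / log2 (INR n))%R.
    by apply: (Rmult_le_reg_r (log2 (INR n))) => //; rewrite /Rdiv Rmult_assoc Rinv_l; lra.
  have ratio_le : (INR n / log2 (INR n) <= INR n)%R.
    apply: (Rmult_le_reg_r (log2 (INR n))) => //; rewrite /Rdiv Rmult_assoc Rinv_l; last lra.
    by nra.
  have [|k [k1 k2]] := @floor_ge_half (Rpower (INR n / log2 (INR n)) (1 / 2 - alpha))%R.
    by apply: Rpower_1_le; lra.
  exists N, k; split.
    apply: batch_code_le_INR HB; apply: Rle_trans kge.
    rewrite Rmult_1_l in k2; apply: (Rle_trans _ _ _ k2).
    by apply: Rle_Rpower_l; lra.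
  split=> //; split=> //.
  apply: (Rle_trans _ _ _ Nle).
  have -> : (5 / 6 + (1 / 2 - alpha) / 3 = 1 - alpha / 3)%R by field.
  have P0 := Rpower_gt0 (INR n) (1 - alpha / 3)%R.
  have Q1 : (1 <= Rpower (log2 (INR n)) (alpha / 3))%R by apply: Rpower_1_le; lra.
  rewrite -[X in (X <= _)%R]Rmult_1_r; apply: Rmult_le_compat_l => //.
  by apply: Rmult_le_pos; lra.
- move=> eps eps_lt; have [C [Nf [kf [C0 H]]]] := codes_theta_below_half eps_lt.
  exists kf, Nf; split; first by apply: (eventually_impl H) => n [].
  have H1 := eventually_and H (eventually_INR_ge 1).
  split=> tau tau0.
    exists (/ 2)%R; split; first lra.
    apply: (eventually_impl H1) => n [[_ [[kge _] _]] n1].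
    apply: Rle_trans kge; apply: Rmult_le_compat_l; first lra.
    by apply: Rle_Rpower; lra.
  exists C; split=> //; apply: (eventually_impl H1) => n [[_ [_ Nle]] n1].
  apply: (Rle_trans _ _ _ Nle); apply: Rmult_le_compat_l; first lra.
  by apply: Rle_Rpower; lra.
- move=> eps eps_lt; have [C [Nf [kf [C0 H]]]] := codes_theta_below_half eps_lt.
  exists kf, Nf; split; first by apply: (eventually_impl H) => n [].
  split.
    exists (/ 2)%R, 1%R; split; first lra; split; first lra.
    by apply: (eventually_impl H) => n [_ []].
  move=> eta eta0; have d0 : (0 < 1 / 6 - eps / 3)%R by lra.
  have H1 := eventually_and H (eventually_and (eventually_INR_ge 1)
    (eventually_Rpower_ge (C * / eta)%R d0)).
  apply: (eventually_impl H1) => n [[_ [_ Nle]] [n1 large]].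
  apply: (Rle_trans _ _ _ Nle).
  have nE : INR n = (Rpower (INR n) (1 / 6 - eps / 3) * Rpower (INR n) (5 / 6 + eps / 3))%R.
    by rewrite -Rpower_plus (_ : (_ + _ = 1)%R) ?Rpower_1; lra.
  rewrite [X in (_ <= _ * X)%R]nE -Rmult_assoc.
  apply: Rmult_le_compat_r; first exact: Rlt_le (Rpower_gt0 _ _).
  have := Rmult_le_compat_l _ _ _ (Rlt_le _ _ eta0) large.
  by have -> : (eta * (C * / eta) = C)%R by field; lra.
- exact: codes_above_half.
Qed.
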